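(* For $a,b,c,d,e,f\in\mathbb{C}$ let $T_{8E}(a,b,c,d,e,f)$ be the $8\times8$ matrix $$ \begin{bmatrix} 1 & 1 & 1 & 1 & 1 & 1 & 1 & 1 \\ 1 & d & e & -f & d f & e f & -d e & d e f \\ 1 & a & -b & f & -a f & b f & a b & a b f \\ 1 & -d & b & c & c d & -b c & b d & b c d \\ 1 & -a & -e & -c & -a c & -c e & -a e & a c e \\ 1 & -a d & b e & -1 & a d & -b e & -a b d e & a b d e \\ 1 & a d & -1 & -c f & -a c d f & c f & -a d & a c d f \\ 1 & -1 & -b e & c f & -c f & -b c e f & b e & b c e f \end{bmatrix}. $$ For $a,b,c\in\mathbb{T}$ let $d'=(-1-b-c+b c)/(-1+b+c+b c)$, $e'=(-1+a+c+a c)/(-1-a-c+a c)$, $f'=(-1-a+b-a b)/(1-a+b+a b)$, and $\mathcal{S}_E(a,b,c)=T_{8E}(a,b,c,d',e',f')$. Then $T^{(3)}_{8E}:=\mathcal{S}_E(\mathbb{T}^3)$ is a $3$-parameter family of complex Hadamard matrices.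
   Context: $\mathbb{T}=\{z\in\mathbb{C}:|z|=1\}$. A matrix $H\in M_n(\mathbb{T})$ is a complex Hadamard matrix of order $n$ if $HH^\dagger=nI$; the set of these is $\mathbb{H}(n)$. A matrix is dephased if its first row and first column consist of ones; the set of dephased complex Hadamard matrices is $\mathbb{H}_d(n)$. A $k$-parameter family of complex Hadamard matrices is a set $f(D)$ where $D\subseteq\mathbb{T}^k$ (parametrized by real angles, so regarded as a subset of $\mathbb{R}^k$) and $f:D\to\mathbb{H}(n)$ is continuous, such that $k$ equals the rank of the Jacobian matrix of $f$ (as a map from real parameters into $\mathbb{C}^{n\times n}\cong\mathbb{R}^{2n^2}$) at some interior point of $D$.
   Formalization: S_E is taken only on the points of T^3 where the denominators of d', e', f' are all nonzero; elsewhere a quotient is 0/0 (e.g. d' at b=i, c=-i) with no continuous extension, so T_8E^(3) is the image of this subset rather than of all T^3. *)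

(* Defs.v *)
From HB Require Import structures.
From mathcomp Require Import all_boot all_order all_algebra.
From mathcomp Require Import all_classical all_reals all_analysis.
From mathcomp Require Import sesquilinear spectral complex.

Set Implicit Arguments.
Unset Strict Implicit.
Unset Printing Implicit Defensive.

Import Order.TTheory GRing.Theory Num.Theory.
Import numFieldNormedType.Exports.

Local Open Scope classical_set_scope.
Local Open Scope sesquilinear_scope.
Local Open Scope complex_scope.
Local Open Scope ring_scope.

(* MathComp-Analysis puts the norm topology on [K^o] for [K : numFieldType];
   [R[i]] is a concrete type, so it has to be equipped explicitly.  The topology
   of matrices over [R[i]] is then the entrywise one. *)
HB.instance Definition _ (R : realType) := PseudoPointedMetric.copy R[i] R[i]^o.

Definition unimodular (R : realType) (m n : nat) (M : 'M[R[i]]_(m, n)) : Prop :=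
  forall i j, `|M i j| = 1.

Definition torus (R : realType) (k : nat) : set 'rV[R[i]]_k :=
  [set x | unimodular x].

Definition complex_hadamard (R : realType) (n : nat) : set 'M[R[i]]_n :=
  [set H | unimodular H /\ H *m H^t* = (n%:R)%:M].

Definition expi (R : realType) (t : R) : R[i] := cos t +i* sin t.

Definition angles (R : realType) (k : nat) (t : 'rV[R]_k) : 'rV[R[i]]_k :=
  map_mx (@expi R) t.

(* The identification of C^(n x n) with R^(2 n^2). *)
Definition realify (R : realType) (n : nat) (M : 'M[R[i]]_n) :
    'rV[R]_(n * n + n * n) :=
  row_mx (mxvec (map_mx (@complex.Re R) M)) (mxvec (map_mx (@complex.Im R) M)).

(* [F] is a [k]-parameter family of complex Hadamard matrices of order [n],
   namely [F = f(D)].  The map [f] is total, but only its values on [D] matter: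
   continuity is that of the restriction to [D], and the Jacobian is taken at an
   interior point of [D], seen in angle coordinates as a subset of R^k.
   Differentiability is required there because the library's Jacobian of a
   non-differentiable map is meaningless. *)
Definition parameter_family (R : realType) (k n : nat)
    (D : set 'rV[R[i]]_k) (f : 'rV[R[i]]_k -> 'M[R[i]]_n)
    (F : set 'M[R[i]]_n) : Prop :=
  let g := fun t : 'rV[R]_k => realify (f (angles t)) in
  [/\ F = f @` D,
      D `<=` @torus R k,
      forall x, D x -> complex_hadamard (f x),
      {within D, continuous f} &
      exists t : 'rV[R]_k,
        [/\ (@angles R k @^-1` D)° t,
            differentiable g t &
            \rank ('J g t) = k]].

Section T8E.
Context {R : realType}.
Implicit Types a b c d e f : R[i].

Definition T8E a b c d e f : 'M[R[i]]_8 :=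
  \matrix_(i, j) nth 0 (nth [::]
   [:: [:: 1; 1; 1; 1; 1; 1; 1; 1];
       [:: 1; d; e; - f; d * f; e * f; - (d * e); d * e * f];
       [:: 1; a; - b; f; - (a * f); b * f; a * b; a * b * f];
       [:: 1; - d; b; c; c * d; - (b * c); b * d; b * c * d];
       [:: 1; - a; - e; - c; - (a * c); - (c * e); - (a * e); a * c * e];
       [:: 1; - (a * d); b * e; - 1; a * d; - (b * e); - (a * b * d * e);
           a * b * d * e];
       [:: 1; a * d; - 1; - (c * f); - (a * c * d * f); c * f; - (a * d);
           a * c * d * f];
       [:: 1; - 1; - (b * e); c * f; - (c * f); - (b * c * e * f); b * e;
           b * c * e * f]] i) j.

Definition d'_num b c : R[i] := - 1 - b - c + b * c.
Definition d'_den b c : R[i] := - 1 + b + c + b * c.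
Definition e'_num a c : R[i] := - 1 + a + c + a * c.
Definition e'_den a c : R[i] := - 1 - a - c + a * c.
Definition f'_num a b : R[i] := - 1 - a + b - a * b.
Definition f'_den a b : R[i] := 1 - a + b + a * b.

Definition S_E (x : 'rV[R[i]]_3) : 'M[R[i]]_8 :=
  let a := x 0 0 in let b := x 0 1 in let c := x 0 2%:R in
  T8E a b c (d'_num b c / d'_den b c) (e'_num a c / e'_den a c)
    (f'_num a b / f'_den a b).

(* The subset of T^3 where the three quotients make sense.  It is not all of
   T^3: for instance [d'_num] and [d'_den] both vanish at b = i, c = - i, and
   d' has no limit there. *)
Definition S_E_dom : set 'rV[R[i]]_3 :=
  [set x : 'rV[R[i]]_3 |
    let a := x 0 0 in let b := x 0 1 in let c := x 0 2%:R in
    [/\ torus x, d'_den b c != 0, e'_den a c != 0 & f'_den a b != 0]].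

Definition T8E3 : set 'M[R[i]]_8 := S_E @` S_E_dom.

End T8E.

(* Main.v *)
Require Import Defs.
From mathcomp Require Import all_boot all_order all_algebra.
From mathcomp Require Import all_classical all_reals all_analysis.
From mathcomp Require Import sesquilinear complex ring.

(** For unimodular entries conjugation is inversion, so the inner products of the
    rows of [T8E a b c d e f] are Laurent polynomials.  Off the diagonal each of
    them is either identically zero or a signed monomial times the sum of one of
    the rows 1, 2, 3, 4, i.e. one of four multilinear relations, in [d, e, f], in
    [a, b, f], in [b, c, d] and in [a, c, e].  Solving the last three for [f], [d]
    and [e] gives exactly [f'], [d'] and [e'], and the first one then follows.
    Moreover [d'_den b c]^* = - d'_num b c / (b c), so that [d'] is unimodular, and
    likewise for [e'] and [f'].

    At [a = b = c = 1] the three denominators are 2, -2 and 2, so this is an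
    interior point where the family is differentiable.  Since [a], [b] and [c] are
    themselves entries of the matrix, with imaginary parts the sines of the angles,
    the Jacobian has a right inverse there. *)

Set Implicit Arguments.
Unset Strict Implicit.
Unset Printing Implicit Defensive.

Import Order.TTheory GRing.Theory Num.Theory.
Import numFieldNormedType.Exports.

Local Open Scope classical_set_scope.
Local Open Scope sesquilinear_scope.
Local Open Scope complex_scope.
Local Open Scope ring_scope.

Lemma unimodular_neq0 (C : numDomainType) (z : C) : `|z| = 1 -> z != 0.
Proof. by rewrite -normr_eq0 => ->; rewrite oner_eq0. Qed.

Lemma unimodular_conj (C : numClosedFieldType) (z : C) : `|z| = 1 -> z^* = z^-1.
Proof. by move=> z1; rewrite invC_norm z1 expr1n invr1 mul1r. Qed.

(** * Orthogonality of the rows, over an arbitrary field *)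

Section Gram.
Context {F : fieldType}.
Implicit Types a b c d e f : F.

(** The list inside [T8E], over any field: inverses can then stand for conjugates, which brings the
    inner products within reach of [field]. *)
Definition T8E_rows a b c d e f : seq (seq F) :=
  [:: [:: 1; 1; 1; 1; 1; 1; 1; 1];
      [:: 1; d; e; - f; d * f; e * f; - (d * e); d * e * f];
      [:: 1; a; - b; f; - (a * f); b * f; a * b; a * b * f];
      [:: 1; - d; b; c; c * d; - (b * c); b * d; b * c * d];
      [:: 1; - a; - e; - c; - (a * c); - (c * e); - (a * e); a * c * e];
      [:: 1; - (a * d); b * e; - 1; a * d; - (b * e); - (a * b * d * e);
          a * b * d * e];
      [:: 1; a * d; - 1; - (c * f); - (a * c * d * f); c * f; - (a * d);
          a * c * d * f];
      [:: 1; - 1; - (b * e); c * f; - (c * f); - (b * c * e * f); b * e;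
          b * c * e * f]].

Variables a b c d e f : F.
Hypotheses (a0 : a != 0) (b0 : b != 0) (c0 : c != 0) (d0 : d != 0)
  (e0 : e != 0) (f0 : f != 0).

(* The sums of the rows 1, 2, 3 and 4, numbered from 0. *)
Hypothesis def0 : 1 + d + e - f + d * f + e * f - d * e + d * e * f = 0.
Hypothesis abf0 : 1 + a - b + f - a * f + b * f + a * b + a * b * f = 0.
Hypothesis bcd0 : 1 - d + b + c + c * d - b * c + b * d + b * c * d = 0.
Hypothesis ace0 : 1 - a - e - c - a * c - c * e - a * e + a * c * e = 0.

Let eq0_mull (k x y : F) : x = 0 -> y = k * x -> y = 0.
Proof. by move=> -> ->; rewrite mulr0. Qed.

Ltac field_nz := by field; rewrite ?a0 ?b0 ?c0 ?d0 ?e0 ?f0.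

Ltac multiple_of k :=
  let rel E := first [apply: (@eq0_mull k _ _ E); field_nz
                     |apply: (@eq0_mull (- k) _ _ E); field_nz] in
  first [rel def0 | rel abf0 | rel bcd0 | rel ace0].

Lemma T8E_orthogonal (i j : 'I_8) : (j < i)%N ->
  \sum_(k < 8) nth 0 (nth [::] (T8E_rows a b c d e f) i) k
     * nth 0 (nth [::] (T8E_rows a^-1 b^-1 c^-1 d^-1 e^-1 f^-1) j) k = 0.
Proof.
rewrite !big_ord_recl big_ord0 /=.
case: i j => [[|[|[|[|[|[|[|[|//]]]]]]]] ?] [[|[|[|[|[|[|[|[|//]]]]]]]] ?] //= _.
(* [field_nz] disposes of the products that vanish identically. In the others the cofactor of the
   relation is, up to sign, 1 or the inverse of a single parameter. *)
all: first [ field_nz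
| multiple_of (1 : F)
| multiple_of a^-1 | multiple_of b^-1 | multiple_of c^-1
| multiple_of d^-1 | multiple_of e^-1 | multiple_of f^-1].
Qed.
End Gram.

(** The entries are signed monomials, so a morphism acts on the parameters alone. It is applied to
    conjugation. *)
Lemma T8E_rows_map (F F' : fieldType) (h : {rmorphism F -> F'}) a b c d e f :
  map (map h) (T8E_rows a b c d e f) =
  T8E_rows (h a) (h b) (h c) (h d) (h e) (h f).
Proof. by rewrite /= !(rmorphM, rmorphN, rmorph1). Qed.

Lemma size_T8E_row (F : fieldType) (a b c d e f : F) (i : 'I_8) :
  size (nth [::] (T8E_rows a b c d e f) i) = 8%N.
Proof. by case: i => [[|[|[|[|[|[|[|[|//]]]]]]]] ?]. Qed.

(** * The quotients d', e', f': relations and unimodularity *)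

Section Relations.
Context {F : fieldType} {a b c : F}.
(** Copies of the three quotients over any field, convertible to those in [S_E]. *)
Let d := (- 1 - b - c + b * c) / (- 1 + b + c + b * c).
Let e := (- 1 + a + c + a * c) / (- 1 - a - c + a * c).
Let f := (- 1 - a + b - a * b) / (1 - a + b + a * b).
Hypotheses (d0 : - 1 + b + c + b * c != 0) (e0 : - 1 - a - c + a * c != 0)
  (f0 : 1 - a + b + a * b != 0).

Lemma bcd_relation : 1 - d + b + c + c * d - b * c + b * d + b * c * d = 0.
Proof. by rewrite /d; field. Qed.

Lemma ace_relation : 1 - a - e - c - a * c - c * e - a * e + a * c * e = 0.
Proof. by rewrite /e; field. Qed.

Lemma abf_relation : 1 + a - b + f - a * f + b * f + a * b + a * b * f = 0.
Proof. by rewrite /f; field. Qed.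

Lemma def_relation : 1 + d + e - f + d * f + e * f - d * e + d * e * f = 0.
Proof. by rewrite /d /e /f; field; rewrite d0 e0 f0. Qed.

End Relations.

(** Conjugation preserves the norm and [x * y] has norm 1, so [n] and [m] have equal norms. *)
Lemma norm_unimodular_quotient {C : numClosedFieldType} (x y n m : C) :
  `|x| = 1 -> `|y| = 1 -> m != 0 -> m^* = - n / (x * y) -> `|n / m| = 1.
Proof.
move=> x1 y1 m0 mE; rewrite normf_div.
have -> : `|n| = `|m|.
  by rewrite -[RHS]norm_conjC mE normf_div normrN normrM x1 y1 mulr1 divr1.
by rewrite divff// normr_eq0.
Qed.

Section Unimodular.
Context {C : numClosedFieldType} {a b c : C}.
Hypotheses (a1 : `|a| = 1) (b1 : `|b| = 1) (c1 : `|c| = 1).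

Let a0 := unimodular_neq0 a1.
Let b0 := unimodular_neq0 b1.
Let c0 := unimodular_neq0 c1.

Lemma norm_d' : - 1 + b + c + b * c != 0 ->
  `|(- 1 - b - c + b * c) / (- 1 + b + c + b * c)| = 1.
Proof.
move=> m0; apply: (norm_unimodular_quotient b1 c1) => //.
rewrite !(rmorphD, rmorphB, rmorphN, rmorphM, rmorph1) /= !unimodular_conj//.
by field; rewrite b0 c0.
Qed.

Lemma norm_e' : - 1 - a - c + a * c != 0 ->
  `|(- 1 + a + c + a * c) / (- 1 - a - c + a * c)| = 1.
Proof.
move=> m0; apply: (norm_unimodular_quotient a1 c1) => //.
rewrite !(rmorphD, rmorphB, rmorphN, rmorphM, rmorph1) /= !unimodular_conj//.
by field; rewrite a0 c0.
Qed.

Lemma norm_f' : 1 - a + b + a * b != 0 ->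
  `|(- 1 - a + b - a * b) / (1 - a + b + a * b)| = 1.
Proof.
move=> m0; apply: (norm_unimodular_quotient a1 b1) => //.
rewrite !(rmorphD, rmorphB, rmorphN, rmorphM, rmorph1) /= !unimodular_conj//.
by field; rewrite a0 b0.
Qed.

End Unimodular.

(** * The Hadamard property *)

Section Hadamard.
Context {C : numClosedFieldType} {a b c d e f : C}.
Hypotheses (a1 : `|a| = 1) (b1 : `|b| = 1) (c1 : `|c| = 1)
  (d1 : `|d| = 1) (e1 : `|e| = 1) (f1 : `|f| = 1).

Let H i j := nth 0 (nth [::] (T8E_rows a b c d e f) i) j.

Lemma norm_T8E (i j : 'I_8) : `|H i j| = 1.
Proof.
by rewrite /H; case: i j => [[|[|[|[|[|[|[|[|//]]]]]]]] ?]
  [[|[|[|[|[|[|[|[|//]]]]]]]] ?] /=;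
  rewrite ?(normrM, normrN, normr1, a1, b1, c1, d1, e1, f1, mulr1).
Qed.

Hypothesis def0 : 1 + d + e - f + d * f + e * f - d * e + d * e * f = 0.
Hypothesis abf0 : 1 + a - b + f - a * f + b * f + a * b + a * b * f = 0.
Hypothesis bcd0 : 1 - d + b + c + c * d - b * c + b * d + b * c * d = 0.
Hypothesis ace0 : 1 - a - e - c - a * c - c * e - a * e + a * c * e = 0.

Lemma T8E_gram (i j : 'I_8) : \sum_(k < 8) H i k * (H j k)^* = 8%:R *+ (i == j).
Proof.
have Hneq (i' j' : 'I_8) : (j' < i')%N -> \sum_(k < 8) H i' k * (H j' k)^* = 0.
  move=> ji; rewrite -[RHS](T8E_orthogonal _ _ _ _ _ _ def0 abf0 bcd0 ace0 ji);
    [|exact: unimodular_neq0..].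
  apply: eq_bigr => k _; congr (_ * _).
  (* The inverses turn back into conjugates, and conjugation is pulled out of the list. *)
  rewrite -!unimodular_conj// -T8E_rows_map.
  by rewrite (nth_map [::])// (nth_map 0)// size_T8E_row.
have [->|] := eqVneq i j.
  rewrite (eq_bigr (fun=> 1)) => [|k _]; first by rewrite sumr_const card_ord.
  by rewrite -normCK norm_T8E expr1n.
rewrite mulr0n -val_eqE /= neq_ltn => /orP[ij|]; last exact: Hneq.
(* Above the diagonal, conjugating the sum exchanges the two rows. *)
apply: (can_inj conjCK); rewrite conjC0 rmorph_sum -[RHS](Hneq _ _ ij).
by apply: eq_bigr => k _; rewrite rmorphM /= conjCK mulrC.
Qed.

End Hadamard.

Section Family.
Context {R : realType}.

Lemma S_E_hadamard (x : 'rV[R[i]]_3) :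
  S_E_dom x -> complex_hadamard (S_E x).
Proof.
case=> x1 d0 e0 f0.
have a1 := x1 0 0; have b1 := x1 0 1; have c1 := x1 0 2%:R.
have d1 := norm_d' b1 c1 d0; have e1 := norm_e' a1 c1 e0.
have f1 := norm_f' a1 b1 f0.
split=> [i j|]; first by rewrite mxE; apply: norm_T8E.
apply/matrixP => i j; rewrite !mxE -[RHS](T8E_gram a1 b1 c1 d1 e1 f1
  (def_relation d0 e0 f0) (abf_relation f0) (bcd_relation d0) (ace_relation e0)).
by apply: eq_bigr => k _; rewrite !mxE.
Qed.

End Family.

(** * Continuity and differentiability, entry by entry *)

Lemma cvg_mx (X : Type) (F : set_system X) {FF : Filter F} (T : topologicalType)
    (m n : nat) (h : X -> 'M[T]_(m, n)) (M : 'M[T]_(m, n)) :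
  (forall i j, h x i j @[x --> F] --> M i j) -> h x @[x --> F] --> M.
Proof.
(* [A] contains a product of neighbourhoods [P i j] of the entries, and there are finitely many of
   these. *)
move=> hM A [P MP PA]; apply: filterS (fun x => PA (h x)) _.
apply: filter_forall => i; apply: filter_forall => j; exact: hM (MP i j).
Qed.

Lemma differentiable_rV (R : realFieldType) (V : normedModType R) (n : nat)
    (h : V -> 'rV[R]_n) (x : V) :
  (forall j, differentiable (fun y => h y 0 j) x) -> differentiable h x.
Proof.
move=> dh; have -> : h = \sum_j (fun y => h y 0 j *: delta_mx 0 j).
  by apply/funext => y; rewrite fct_sumE -row_sum_delta.
by apply: differentiable_sum => j; apply: differentiableZl.
Qed.

Section Entries.
Context {R : realType} {T : Type}.
Variables (P : (T -> R[i]) -> Prop) (x0 : T).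
Hypotheses (P1 : P (fun=> 1))
  (PD : forall u v, P u -> P v -> P (fun x => u x + v x))
  (PN : forall u, P u -> P (fun x => - u x))
  (PM : forall u v, P u -> P v -> P (fun x => u x * v x))
  (PV : forall u, P u -> u x0 != 0 -> P (fun x => (u x)^-1)).

(** The entries are rational in the coordinates, with denominators nonzero at [x0]. One induction
    thus serves both continuity and real differentiability at a point. *)
Lemma S_E_entries_ind (y : T -> 'rV[R[i]]_3) (i j : 'I_8) :
  (forall k, P (fun x => y x 0 k)) -> S_E_dom (y x0) ->
  P (fun x => S_E (y x) i j).
Proof.
move=> Py [_ d0 e0 f0].
have Pa := Py 0; have Pb := Py 1; have Pc := Py 2%:R.
have Pd : P (fun x =>
    d'_num (y x 0 1) (y x 0 2%:R) / d'_den (y x 0 1) (y x 0 2%:R)).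
  by apply: PM (PV _ d0); rewrite /d'_num /d'_den; auto 10.
have Pe : P (fun x =>
    e'_num (y x 0 0) (y x 0 2%:R) / e'_den (y x 0 0) (y x 0 2%:R)).
  by apply: PM (PV _ e0); rewrite /e'_num /e'_den; auto 10.
have Pf : P (fun x =>
    f'_num (y x 0 0) (y x 0 1) / f'_den (y x 0 0) (y x 0 1)).
  by apply: PM (PV _ f0); rewrite /f'_num /f'_den; auto 10.
(* As a list entry, the function reduces to an explicit signed monomial once [i] and [j] are
   numerals. *)
rewrite (_ : (fun _ => _) = fun x => nth 0 (nth [::]
    (T8E_rows (y x 0 0) (y x 0 1) (y x 0 2%:R)
      (d'_num (y x 0 1) (y x 0 2%:R) / d'_den (y x 0 1) (y x 0 2%:R))
      (e'_num (y x 0 0) (y x 0 2%:R) / e'_den (y x 0 0) (y x 0 2%:R))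
      (f'_num (y x 0 0) (y x 0 1) / f'_den (y x 0 0) (y x 0 1))) i) j);
  last first.
  by apply/funext => x; rewrite mxE.
by case: i j => [[|[|[|[|[|[|[|[|//]]]]]]]] ?] [[|[|[|[|[|[|[|[|//]]]]]]]] ?] /=;
  auto 10.
Qed.

End Entries.

Lemma S_E_continuous (R : realType) (x : 'rV[R[i]]_3) :
  S_E_dom x -> {for x, continuous (@S_E R)}.
Proof.
move=> Dx; apply: (@cvg_mx _ (nbhs x) (nbhs_filter x)) => i j.
pose P (u : 'rV[R[i]]_3 -> R[i]) := {for x, continuous u}.
have P1 : P (fun=> 1) by exact (@cst_continuous _ _ _ x).
have PD u v : P u -> P v -> P (fun y => u y + v y).
  exact (@continuousD R[i] R[i]^o _ u v x).
have PN u : P u -> P (fun y => - u y) by exact (@continuousN R[i] R[i]^o _ u x).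
have PM u v : P u -> P v -> P (fun y => u y * v y).
  exact (@continuousM _ _ u v x).
have PV u : P u -> u x != 0 -> P (fun y => (u y)^-1).
  by move=> cu u0; exact (@continuousV _ _ u x u0 cu).
have Px k : P (fun y => y 0 k) by exact (@coord_continuous _ _ _ 0 k x).
exact (S_E_entries_ind P1 PD PN PM PV i j Px Dx).
Qed.

(* [R[i]] is not a normed module over [R], so real differentiability of a complex
   valued map is stated on its real and imaginary parts. *)
Section Realification.
Context {R : realType} {V : normedModType R} (x0 : V).
Local Notation Re := (@complex.Re R).
Local Notation Im := (@complex.Im R).

Definition cdifferentiable (u : V -> R[i]) : Prop :=
  differentiable (fun x => Re (u x)) x0 /\ differentiable (fun x => Im (u x)) x0.

Lemma cdifferentiable_cst z : cdifferentiable (fun=> z).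
Proof. by split; apply: differentiable_cst. Qed.

Lemma cdifferentiableD u v : cdifferentiable u -> cdifferentiable v ->
  cdifferentiable (fun x => u x + v x).
Proof.
move=> [ur ui] [vr vi]; split.
  rewrite (_ : (fun _ => _) = (fun x => Re (u x)) + (fun x => Re (v x))).
    exact: differentiableD.
  by apply/funext => x; rewrite fctE; case: (u x) (v x) => [? ?] [? ?].
rewrite (_ : (fun _ => _) = (fun x => Im (u x)) + (fun x => Im (v x))).
  exact: differentiableD.
by apply/funext => x; rewrite fctE; case: (u x) (v x) => [? ?] [? ?].
Qed.

Lemma cdifferentiableN u : cdifferentiable u -> cdifferentiable (fun x => - u x).
Proof.
move=> [ur ui]; split.
  rewrite (_ : (fun _ => _) = - (fun x => Re (u x))).
    exact: differentiableN.
  by apply/funext => x; rewrite fctE; case: (u x).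
rewrite (_ : (fun _ => _) = - (fun x => Im (u x))).
  exact: differentiableN.
by apply/funext => x; rewrite fctE; case: (u x).
Qed.

Lemma cdifferentiableM u v : cdifferentiable u -> cdifferentiable v ->
  cdifferentiable (fun x => u x * v x).
Proof.
move=> [ur ui] [vr vi]; split.
  rewrite (_ : (fun _ => _) = (fun x => Re (u x)) * (fun x => Re (v x))
                            - (fun x => Im (u x)) * (fun x => Im (v x))).
    by apply: differentiableB; apply: differentiableM.
  by apply/funext => x; rewrite !fctE; case: (u x) (v x) => [? ?] [? ?].
rewrite (_ : (fun _ => _) = (fun x => Re (u x)) * (fun x => Im (v x))
                          + (fun x => Im (u x)) * (fun x => Re (v x))).
  by apply: differentiableD; apply: differentiableM.
by apply/funext => x; rewrite !fctE; case: (u x) (v x) => [? ?] [? ?].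
Qed.

Lemma cdifferentiableV u : cdifferentiable u -> u x0 != 0 ->
  cdifferentiable (fun x => (u x)^-1).
Proof.
move=> [ur ui] u0.
(* The squared norm of [u x]: the inverse of [u x] is its conjugate divided by [n2 x]. *)
pose n2 x := Re (u x) * Re (u x) + Im (u x) * Im (u x).
have dn2 : differentiable (fun x => (n2 x)^-1) x0.
  apply: differentiableV.
    by apply: differentiableD; apply: differentiableM.
  apply: contra u0; rewrite /n2 -!expr2 paddr_eq0 ?sqr_ge0// !sqrf_eq0.
  by rewrite eq_complex.
split.
  rewrite (_ : (fun _ => _) = (fun x => Re (u x)) * (fun x => (n2 x)^-1)).
    exact: differentiableM.
  by apply/funext => x; rewrite !fctE /n2 -!expr2; case: (u x).
rewrite (_ : (fun _ => _) = - ((fun x => Im (u x)) * (fun x => (n2 x)^-1))).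
  by apply: differentiableN; apply: differentiableM.
by apply/funext => x; rewrite !fctE /n2 -!expr2; case: (u x).
Qed.

(** The real or the imaginary part is nonzero at [x0], and by continuity it stays so nearby. *)
Lemma cdifferentiable_near_neq0 u : cdifferentiable u -> u x0 != 0 ->
  \forall x \near x0, u x != 0.
Proof.
move=> [/differentiable_continuous ur /differentiable_continuous ui].
rewrite eq_complex negb_and => /orP[r0|i0].
  by apply: filterS (cvgr_neq0 _ ur r0) => x; apply: contra_neq => ->.
by apply: filterS (cvgr_neq0 _ ui i0) => x; apply: contra_neq => ->.
Qed.

Lemma differentiable_realify n (h : V -> 'M[R[i]]_n) :
  (forall i j, cdifferentiable (fun x => h x i j)) ->
  differentiable (fun x => realify (h x)) x0.
Proof.
move=> dh; apply: differentiable_rV => l.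
case: (split_ordP l) => k ->; case/mxvec_indexP: k => i j.
- rewrite (_ : (fun _ => _) = fun x => Re (h x i j)); first by case: (dh i j).
  by apply/funext => x; rewrite row_mxEl mxvecE mxE.
- rewrite (_ : (fun _ => _) = fun x => Im (h x i j)); first by case: (dh i j).
  by apply/funext => x; rewrite row_mxEr mxvecE mxE.
Qed.

End Realification.

(** * Angle coordinates on the torus *)

Section Angles.
Context {R : realType} {k : nat}.

Lemma differentiable_cos (x : R) : differentiable (@cos R) x.
Proof. by apply/derivable1_diffP. Qed.

Lemma differentiable_sin (x : R) : differentiable (@sin R) x.
Proof. by apply/derivable1_diffP. Qed.

Lemma torus_angles (t : 'rV[R]_k) : torus (angles t).
Proof.
by move=> i j; rewrite mxE normc_def/= cos2Dsin2 sqrtr1.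
Qed.

Lemma cdifferentiable_angles (t : 'rV[R]_k) (j : 'I_k) :
  cdifferentiable t (fun s => angles s 0 j).
Proof.
split.
  rewrite (_ : (fun _ => _) = @cos R \o (fun s : 'rV[R]_k => s 0 j)).
    apply: differentiable_comp (differentiable_cos _).
    exact: differentiable_coord.
  by apply/funext => s; rewrite mxE.
rewrite (_ : (fun _ => _) = @sin R \o (fun s : 'rV[R]_k => s 0 j)).
  apply: differentiable_comp (differentiable_sin _).
  exact: differentiable_coord.
by apply/funext => s; rewrite mxE.
Qed.

Lemma derive_coord (t v : 'rV[R]_k) (j : 'I_k) :
  'D_v (fun s : 'rV[R]_k => s 0 j) t = v 0 j.
Proof.
(* The derivative of the identity map, taken entry by entry. *)
have /(congr1 (fun M : 'rV[R]_k => M 0 j)) := derive_mx (@derivable_id _ _ t v).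
by rewrite derive_id mxE => <-.
Qed.

Lemma derive_sin_coord (t v : 'rV[R]_k) (j : 'I_k) :
  'D_v (fun s : 'rV[R]_k => sin (s 0 j)) t = v 0 j * cos (t 0 j).
Proof.
have dcoord := @differentiable_coord R 1 k t 0 j.
have dsin := differentiable_sin (t 0 j).
rewrite deriveE; last exact: (differentiable_comp dcoord dsin).
rewrite (diff_comp dcoord dsin) /= -(deriveE _ dcoord) derive_coord.
by rewrite diff1E// derive1E derive_val.
Qed.

End Angles.

(** * The family near angle 0 and the rank of its Jacobian there *)

Section Rank.
Context {R : realType}.

Let S_E_dom0 : @S_E_dom R (angles 0).
Proof.
have expi0 k : @angles R 3 0 0 k = 1 by rewrite !mxE /expi sin0 cos0.
rewrite /S_E_dom /= /d'_den /e'_den /f'_den !expi0.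
split; first exact: torus_angles.
- by rewrite mulr1 addNr add0r -mulr2n pnatr_eq0.
- by rewrite mulr1 -addrA addNr addr0 -opprD oppr_eq0 -mulr2n pnatr_eq0.
- by rewrite mulr1 subrr add0r -mulr2n pnatr_eq0.
Qed.

(** Angles always give points of the torus, so only the three denominators have to stay nonzero near
    0. *)
Lemma S_E_dom_nbhs0 : (@angles R 3 @^-1` @S_E_dom R)° 0.
Proof.
have [_ d0 e0 f0] := S_E_dom0.
have dD := @cdifferentiableD R _ (0 : 'rV[R]_3).
have dN := @cdifferentiableN R _ (0 : 'rV[R]_3).
have dM := @cdifferentiableM R _ (0 : 'rV[R]_3).
have d1 := @cdifferentiable_cst R _ (0 : 'rV[R]_3) 1.
pose x (t : 'rV[R]_3) k := angles t 0 k.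
have dx k : cdifferentiable 0 (fun t => x t k).
  exact: cdifferentiable_angles.
have Pd : cdifferentiable 0 (fun t => d'_den (x t 1) (x t 2%:R)).
  by rewrite /d'_den; auto 10.
have Pe : cdifferentiable 0 (fun t => e'_den (x t 0) (x t 2%:R)).
  by rewrite /e'_den; auto 10.
have Pf : cdifferentiable 0 (fun t => f'_den (x t 0) (x t 1)).
  by rewrite /f'_den; auto 10.
near=> t; split; first exact: torus_angles.
- near: t; exact: (cdifferentiable_near_neq0 Pd d0).
- near: t; exact: (cdifferentiable_near_neq0 Pe e0).
- near: t; exact: (cdifferentiable_near_neq0 Pf f0).
Unshelve. all: by end_near. Qed.

Let g (t : 'rV[R]_3) := realify (S_E (angles t)).

Lemma differentiable_S_E : differentiable g 0.
Proof.
apply: differentiable_realify => i j.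
apply: (S_E_entries_ind (P := cdifferentiable 0) (x0 := 0)) S_E_dom0.
- exact: cdifferentiable_cst.
- exact: cdifferentiableD.
- exact: cdifferentiableN.
- exact: cdifferentiableM.
- exact: cdifferentiableV.
- exact: cdifferentiable_angles.
Qed.

Lemma rank_jacobian_S_E : \rank ('J g 0) = 3%N.
Proof.
(* positions of the entries [a], [b] and [c] *)
pose pos (k : 'I_3) : 'I_8 * 'I_8 := nth (ord0, ord0)
  [:: (inord 2, inord 1); (inord 3, inord 2); (inord 3, inord 3)] k.
(* [rshift] points into the imaginary half of [realify], where these entries become sines. *)
pose col k : 'I_(8 * 8 + 8 * 8) := rshift _ (mxvec_index (pos k).1 (pos k).2).
have gcol t k : g t 0 (col k) = sin (t 0 k).
  rewrite row_mxEr mxvecE !mxE /pos.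
  by case: k => [[|[|[|//]]] k3] /=; rewrite !inordK//=;
    congr (sin (t 0 _)); apply: val_inj.
suff /eqP : row_free ('J g 0) by [].
apply/row_freeP.
(* This matrix selects the columns [col k]. What remains are the derivatives at 0 of [sin (t 0 k)]
   along the basis vectors, which form the identity because cos 0 = 1. *)
exists (\matrix_(l, k) (l == col k)%:R); apply/matrixP => i k.
rewrite mxE (bigD1 (col k))//= mxE eqxx mulr1 big1 ?addr0; last first.
  by move=> l /negPf lk; rewrite mxE lk mulr0.
have -> : 'J g 0 i (col k) = row i ('J g 0) 0 (col k) by rewrite [RHS]mxE.
have dg := differentiable_S_E.
(* Row [i] of the Jacobian is the derivative along the [i]-th basis vector. *)
rewrite rowE -deriveEjacobian// derive_mx; last exact: diff_derivable.
rewrite mxE (_ : (fun _ => _) = fun t : 'rV_3 => sin (t 0 k)); last first.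
  by apply/funext => t; rewrite gcol.
by rewrite derive_sin_coord !mxE cos0 mulr1 eqxx /= eq_sym.
Qed.

End Rank.

Theorem theorem4p7 (R : realType) :
  @parameter_family R 3 8 (@S_E_dom R) (@S_E R) (@T8E3 R).
Proof.
split => //.
- by move=> x [].
- exact: S_E_hadamard.
(* Continuity at each point of the domain within the whole space implies continuity of the
   restriction. *)
- by apply: continuous_in_subspaceT => x /set_mem; exact: S_E_continuous.
- exists 0; split; [exact: S_E_dom_nbhs0|exact: differentiable_S_E|].
  exact: rank_jacobian_S_E.
Qed.
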